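(* Let $\mathbf{V}$ be a pseudovariety of groups that is closed under extensions with abelian kernel, and let $F$ be a free group. Let $n\geq 1$ and let $H_1,\dots,H_n$ be finitely generated subgroups of $F$ which are closed in the pro-$\mathbf{V}$ topology of $F$. Then the product set $H_1\cdots H_n=\{h_1\cdots h_n : h_i\in H_i\}$ is also closed in the pro-$\mathbf{V}$ topology of $F$.
   Context: A pseudovariety of groups is a class $\mathbf{V}$ of finite groups (closed under isomorphism) that is closed under taking subgroups, quotients, and finite direct products. It is closed under extensions with abelian kernel if, for every group $G$ and every normal abelian subgroup $N\trianglelefteq G$, $N\in\mathbf{V}$ and $G/N\in\mathbf{V}$ imply $G\in\mathbf{V}$. For a group $G$, the pro-$\mathbf{V}$ topology of $G$ is the group topology for which the normal subgroups $N\trianglelefteq G$ with $G/N\in\mathbf{V}$ form a neighborhood base at the identity. *)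

(* Defs.v *)
From HB Require Import structures.
From mathcomp Require Import all_boot all_order all_fingroup.
From mathcomp Require Import all_classical.
From mathcomp Require Import topology.

Set Implicit Arguments.
Unset Strict Implicit.
Unset Printing Implicit Defensive.

Local Open Scope classical_set_scope.
Local Open Scope group_scope.

(* Closure under products is over arbitrary finite families; the empty family
   puts the trivial group in the class. *)
Record pseudovariety := Pseudovariety {
  pv_class :> forall gT : finGroupType, {group gT} -> Prop;
  pv_isog : forall (gT rT : finGroupType) (G : {group gT}) (H : {group rT}),
    G \isog H -> pv_class G -> pv_class H;
  pv_sub : forall (gT : finGroupType) (G H : {group gT}),
    H \subset G -> pv_class G -> pv_class H;
  pv_quotient : forall (gT : finGroupType) (G N : {group gT}),
    N <| G -> pv_class G -> pv_class (G / N)%G;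
  pv_prod : forall (I : finType) (gT : I -> finGroupType)
      (G : forall i, {group gT i}),
    (forall i, pv_class (G i)) -> pv_class (setXn_group G)
}.

Definition abelian_extension_closed (V : pseudovariety) : Prop :=
  forall (gT : finGroupType) (G N : {group gT}),
    N <| G -> abelian N -> V gT N -> V _ (G / N)%G -> V gT G.

Section Groups.
Variable F : groupType.
Implicit Types (H N A B C D : set F) (x y : F).

Definition subgroup H : Prop := group_closed [in H].

Definition normal_subgroup N : Prop :=
  subgroup N /\ forall x y, N x -> N (x ^ y).

Definition subgroup_generated A : set F := smallest subgroup A.

Definition finitely_generated H : Prop :=
  exists2 A, finite_set A & H = subgroup_generated A.

Definition set_mulg A B : set F := [set x * y | x in A & y in B].

Definition left_coset N x : set F := [set x * y | y in N].

Definition left_cosets N : set (set F) := range (left_coset N).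

(* F / N is the set of cosets under the product of subsets; as V consists of
   finite groups and is closed under isomorphism, F / N is in V when it is
   isomorphic to a member of V. *)
Definition quotient_in (V : pseudovariety) N : Prop :=
  exists (gT : finGroupType) (G : {group gT}) (f : set F -> gT),
    [/\ V gT G, set_bij (left_cosets N) [set` G] f
      & {in left_cosets N &, forall C D, f (set_mulg C D) = f C * f D}].

Definition free_basis (B : set F) : Prop :=
  forall (G : groupType) (f : F -> G),
    exists! phi : F -> G, monoid_morphism phi /\ {in B, phi =1 f}.

End Groups.

Definition free_group (F : groupType) : Prop := exists B : set F, free_basis B.

Section QuotientIn.
Variables (V : pseudovariety) (F : groupType).
Implicit Types (N : set F) (x y : F).

Lemma subgroup1 N : subgroup N -> N 1.
Proof. by case=> /set_mem. Qed.

Lemma subgroupM N x y : subgroup N -> N x -> N y -> N (x * y).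
Proof.
by move=> sN /mem_set Nx /mem_set Ny; apply/set_mem; exact: group_closedM sN _ _ Nx Ny.
Qed.

Lemma subgroupV N x : subgroup N -> N x -> N x^-1.
Proof.
by move=> sN /mem_set Nx; apply/set_mem; exact: group_closedV sN _ Nx.
Qed.

Lemma left_coset_id N x : subgroup N -> left_coset N x x.
Proof. by move=> sN; exists 1; rewrite ?mulg1//; exact: subgroup1. Qed.

Lemma left_cosetP N x y : left_coset N x y <-> N (x^-1 * y).
Proof.
split=> [[z Nz <-]|Nxy]; first by rewrite mulKg.
by exists (x^-1 * y); rewrite ?mulVKg.
Qed.

Lemma left_coset_eq N x y :
  subgroup N -> N (x^-1 * y) -> left_coset N x = left_coset N y.
Proof.
move=> sN Nxy; apply/seteqP; split=> z /left_cosetP Nz; apply/left_cosetP.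
  have := subgroupM sN (subgroupV sN Nxy) Nz.
  by rewrite invMg invgK -mulgA mulVKg.
by have := subgroupM sN Nxy Nz; rewrite -mulgA mulVKg.
Qed.

Lemma left_cosetM N x y : normal_subgroup N ->
  set_mulg (left_coset N x) (left_coset N y) = left_coset N (x * y).
Proof.
move=> [sN nN]; apply/seteqP; split.
  move=> _ [_ [a Na <-] [_ [b Nb <-] <-]].
  exists (a ^ y * b); first by apply: subgroupM => //; exact: nN.
  by rewrite /conjg !mulgA mulgK.
move=> _ [a Na <-]; exists x; first exact: left_coset_id.
by exists (y * a); [exists a | rewrite mulgA].
Qed.

Lemma quotient_inP N :
  (normal_subgroup N /\ quotient_in V N) <->
  exists (gT : finGroupType) (G : {group gT}) (phi : F -> gT),
    [/\ V gT G, monoid_morphism phi, range phi = [set` G]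
      & N = phi @^-1` [set 1]].
Proof.
split.
  move=> [nN [gT [G [f [VG [fG fI fS] fM]]]]].
  have cosN x : left_coset N x \in left_cosets N by apply/mem_set; exists x.
  pose phi x := f (left_coset N x).
  have phiM : {morph phi : x y / x * y}.
    by move=> x y; rewrite /phi -left_cosetM// fM.
  have phi1 : phi 1 = 1 by apply: (mulgI (phi 1)); rewrite -phiM !mulg1.
  exists gT, G, phi; split=> //.
    apply/seteqP; split=> [_ [x _ <-]|g /fS[_ [x _ <-] <-]]; last by exists x.
    by apply: fG; exists x.
  apply/seteqP; split=> x /=.
    move=> Nx; rewrite -phi1; congr f; apply/esym/left_coset_eq; first by case: nN.
    by rewrite invg1 mul1g.
  rewrite -phi1 => /fI; move=> /(_ (cosN _) (cosN _)) eqN.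
  have : left_coset N x x by apply: left_coset_id; case: nN.
  by rewrite eqN => /left_cosetP; rewrite invg1 mul1g.
move=> [gT [G [phi [VG [phi1 phiM] phiG NE]]]].
have NP x : N x = (phi x = 1) by rewrite NE.
have phiV x : phi x^-1 = (phi x)^-1.
  by apply: (mulgI (phi x)); rewrite -phiM !mulgV phi1.
have sN : subgroup N.
  split; first by apply/mem_set; rewrite NP.
  move=> x y /set_mem Nx /set_mem Ny; apply/mem_set.
  by move: Nx Ny; rewrite !NP phiM phiV => -> ->; rewrite mulgV.
have nN : normal_subgroup N.
  by split=> // x y Nx; move: Nx; rewrite !NP /conjg !phiM phiV => ->; rewrite mul1g mulVg.
split=> //.
pose f (C : set F) := phi (xget 1 C).
have fE x : f (left_coset N x) = phi x.
  rewrite /f; have := xgetPex 1 (ex_intro _ x (left_coset_id x sN)).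
  move=> /left_cosetP; rewrite NP phiM phiV => /(congr1 (mulg (phi x))).
  by rewrite mulVKg mulg1.
exists gT, G, f; split=> //.
  split.
  - by move=> _ [x _ <-]; rewrite fE -phiG; exists x.
  - move=> C D /set_mem[x _ <-] /set_mem[y _ <-]; rewrite !fE => pxy.
    by apply: left_coset_eq => //; rewrite NP phiM phiV pxy mulVg.
  - by rewrite -phiG => _ [x _ <-]; exists (left_coset N x); rewrite ?fE//; exists x.
move=> C D /set_mem[x _ <-] /set_mem[y _ <-].
by rewrite left_cosetM// !fE phiM.
Qed.

Lemma quotient_inT : normal_subgroup (setT : set F) /\ quotient_in V (setT : set F).
Proof.
apply/quotient_inP.
pose gT (i : 'I_0) : finGroupType := {perm bool}.
exists {dffun forall i, gT i}, 1%G, (fun=> 1); split.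
- apply: (@pv_sub V _ (setXn_group (fun i => 1%G : {group gT i}))).
    exact: sub1G.
  by apply: pv_prod; case.
- by split=> // x y; rewrite mulg1.
- apply/seteqP; split=> [_ [x _ <-]|x] /=; first exact: group1.
  by rewrite inE => /eqP ->; exists 1.
- by apply/seteqP; split.
Qed.

Lemma quotient_inI N1 N2 :
  normal_subgroup N1 /\ quotient_in V N1 ->
  normal_subgroup N2 /\ quotient_in V N2 ->
  normal_subgroup (N1 `&` N2) /\ quotient_in V (N1 `&` N2).
Proof.
move=> /quotient_inP[gT1 [G1 [p1 [VG1 [p11 p1M] p1G ->]]]].
move=> /quotient_inP[gT2 [G2 [p2 [VG2 [p21 p2M] p2G ->]]]].
apply/quotient_inP.
pose gT (b : bool) : finGroupType := if b then gT1 else gT2.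
pose G (b : bool) : {group gT b} :=
  if b return {group gT b} then G1 else G2.
pose p (x : F) : {dffun forall b, gT b} :=
  [ffun b => if b return gT b then p1 x else p2 x].
have pM : {morph p : x y / x * y}.
  by move=> x y; apply/ffunP => -[]; rewrite !ffunE ?p1M ?p2M.
have p1' : p 1 = 1 by apply/ffunP => -[]; rewrite !ffunE ?p11 ?p21.
pose S : {set {dffun forall b, gT b}} := [set u in range p]%SET.
have SP u : reflect (exists x, p x = u) (u \in S).
  rewrite inE; apply: (iffP idP) => [/set_mem[x _ <-]|[x <-]]; first by exists x.
  by apply/mem_set; exists x.
have gS : group_set S.
  apply/group_setP; split; first by apply/SP; exists 1.
  by move=> _ _ /SP[x <-] /SP[y <-]; apply/SP; exists (x * y).
exists {dffun forall b, gT b}, (Group gS), p; split=> //.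
- apply: (@pv_sub V _ (setXn_group G)); last by apply: pv_prod; case.
  apply/fintype.subsetP => _ /SP[x <-]; apply/setXnP => -[]; rewrite ffunE/=.
    by have : range p1 (p1 x) by [exists x]; rewrite p1G.
  by have : range p2 (p2 x) by [exists x]; rewrite p2G.
- by apply/seteqP; split=> [y [x _ xy]|y /SP[x <-]]; [apply/SP; exists x | exists x].
- apply/seteqP; split=> x /=.
    by move=> [px1 px2]; apply/ffunP => -[]; rewrite !ffunE ?px1 ?px2.
  by move=> /ffunP px; split; [have := px true | have := px false]; rewrite !ffunE.
Qed.

End QuotientIn.

(* F equipped with its pro-V topology. *)
Definition proV (V : pseudovariety) (F : groupType) : Type := F.

Section ProV.
Variables (V : pseudovariety) (F : groupType).

HB.instance Definition _ := Choice.copy (proV V F) F.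

Definition proV_nbhs (x : proV V F) : set_system (proV V F) :=
  filter_from [set N : set F | normal_subgroup N /\ quotient_in V N]
              (fun N => left_coset N (x : F)).

HB.instance Definition _ := hasNbhs.Build (proV V F) proV_nbhs.

Lemma proV_nbhs_filter (x : proV V F) : ProperFilter (nbhs x).
Proof.
apply: filter_from_proper; last first.
  by move=> N [[sN _] _]; exists (x : F); exact: left_coset_id.
apply: filter_from_filter; first by exists setT; exact: quotient_inT.
move=> N1 N2 N1V N2V; exists (N1 `&` N2); first exact: quotient_inI.
by move=> _ [y [Ny1 Ny2] <-]; split; exists y.
Qed.

Lemma proV_nbhs_singleton (x : proV V F) (A : set (proV V F)) :
  nbhs x A -> A x.
Proof. by move=> [N [[sN _] _]]; apply; exact: left_coset_id. Qed.

Lemma proV_nbhs_nbhs (x : proV V F) (A : set (proV V F)) :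
  nbhs x A -> nbhs x (nbhs^~ A).
Proof.
move=> [N [[sN nN] VN] NA]; exists N => // y /left_cosetP Ny.
by exists N => //; rewrite -(left_coset_eq sN Ny).
Qed.

HB.instance Definition _ := Nbhs_isNbhsTopological.Build (proV V F)
  proV_nbhs_filter proV_nbhs_singleton proV_nbhs_nbhs.

Lemma proV_mulg_continuous :
  continuous (fun z : proV V F * proV V F =>
    ((z.1 : F) * (z.2 : F) : F) : proV V F).
Proof.
move=> [x y] A [N NV NA]; have [[sN nN] VN] := NV.
exists (left_coset N (x : F), left_coset N (y : F)) => /=.
  by split; exists N.
move=> [a b] /= [ax yb]; apply: NA.
by rewrite -left_cosetM//; exists a => //; exists b.
Qed.

Lemma proV_invg_continuous :
  continuous (fun x : proV V F => ((x : F)^-1 : F) : proV V F).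
Proof.
move=> x A [N NV NA]; have [[sN nN] VN] := NV.
exists N => // _ [n Nn <-]; apply: NA; apply/left_cosetP.
have := nN _ (x : F)^-1 (subgroupV sN Nn).
by rewrite /conjg invMg.
Qed.

End ProV.

(* Main.v *)
Require Import Defs.
From HB Require Import structures.
From mathcomp Require Import all_boot all_order all_fingroup.
From mathcomp Require Import ssralg zmodp cyclic.
From mathcomp Require Import all_classical.
From mathcomp Require Import topology.

(* Let Gamma_i be a finite connected piece of the Schreier graph of H_i in which
   every element of H_i can be read as a loop, and phi a homomorphism onto a
   group of V that separates the vertices of the Gamma_i; it exists because the
   H_i are closed. If phi maps to G, extend it by the flow modulo m on the edges
   of the Cayley graph of G, for an m with Z/m in V; the kernel of the extension
   is abelian, so its image is again in V.
   Claim: after n extensions, if q_1 ... q_n is mapped to 1, where q_i is read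
   along a walk from u_i to v_i in some Gamma_j, then there are walks with the
   same endpoints whose labels q_i' satisfy q_1' ... q_n' = 1 in the free group.
   One level below, the walks q_i lift to a closed walk in the Cayley graph of G
   with zero flow, so each edge carrying the flow of q_1 also lies in the lift of
   another Gamma_j. Every such edge yields shorter closed products, to which the
   claim applies by induction, and a cut argument propagates the conclusion from
   the origin of q_1 to its end.
   The theorem is the case of w^-1 h_1, h_2, ..., h_n: the walks of the first
   label lead from H_1 w to H_1. If V has only trivial groups, then H_i = F. *)

Set Implicit Arguments.
Unset Strict Implicit.
Unset Printing Implicit Defensive.

Import GRing.Theory.
Local Open Scope classical_set_scope.
Local Open Scope group_scope.

(** * Homomorphisms and labelled walks *)

Section Morphism.
Variables (F G : groupType) (phi : F -> G).
Hypothesis phiP : monoid.monoid_morphism phi.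

Lemma mmorph1 : phi 1 = 1. Proof. by case: phiP. Qed.
Lemma mmorphM x y : phi (x * y) = phi x * phi y. Proof. by case: phiP. Qed.
Lemma mmorphV x : phi x^-1 = (phi x)^-1.
Proof. by apply: (mulgI (phi x)); rewrite -mmorphM !mulgV mmorph1. Qed.

End Morphism.

Section Walks.
Variables (F : groupType) (X : Type) (E : X -> F -> X -> Prop).
Implicit Types (u v w : X) (x y z b : F) (s t : seq (X * F * X)).

Inductive walk u : F -> X -> Prop :=
| walk_nil : walk u 1 u
| walk_fwd z v b w : walk u z v -> E v b w -> walk u (z * b) w
| walk_bwd z v b w : walk u z v -> E w b v -> walk u (z * b^-1) w.

Lemma walk_edge u b v : E u b v -> walk u b v.
Proof. by move=> e; rewrite -[b]mul1g; apply: walk_fwd e; exact: walk_nil. Qed.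

Lemma walk_cat u v w x y : walk u x v -> walk v y w -> walk u (x * y) w.
Proof.
move=> ux; elim=> [|z v' b w' _ IH e|z v' b w' _ IH e]; first by rewrite mulg1.
  by rewrite mulgA; exact: walk_fwd IH e.
by rewrite mulgA; exact: walk_bwd IH e.
Qed.

Lemma walk_rev u v x : walk u x v -> walk v x^-1 u.
Proof.
elim=> [|z v' b w' _ IH e|z v' b w' _ IH e]; first by rewrite invg1; exact: walk_nil.
  rewrite invMg; apply: walk_cat IH.
  by rewrite -[b^-1]mul1g; apply: walk_bwd e; exact: walk_nil.
by rewrite invMg invgK; apply: walk_cat IH; exact: walk_edge.
Qed.

Definition ends (p : X * F * X) : X * X := (p.1.1, p.2).

Fixpoint walks s : Prop :=
  if s is p :: s' then walk p.1.1 p.1.2 p.2 /\ walks s' else True.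

Definition label s : F := \prod_(p <- s) p.1.2.

Fixpoint walkset (t : seq (X * X)) y : Prop :=
  if t is p :: t' then
    exists x z, [/\ walk p.1 x p.2, walkset t' z & y = x * z]
  else y = 1.

Lemma walkset_consP p (t : seq (X * X)) y : walkset (p :: t) y <->
  exists x z, [/\ walk p.1 x p.2, walkset t z & y = x * z].
Proof. by []. Qed.

Lemma label_cons p s : label (p :: s) = p.1.2 * label s.
Proof. by rewrite /label big_cons. Qed.

Lemma label_cat s t : label (s ++ t) = label s * label t.
Proof. by rewrite /label big_cat. Qed.

Lemma walks_cat s t : walks (s ++ t) <-> walks s /\ walks t.
Proof.
elim: s => [|p s IH] /=; first by split=> [//|[]].
by rewrite IH; split=> [[? []]|[[]]].
Qed.

Lemma walkset_catP (s t : seq (X * X)) y : walkset (s ++ t) y <->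
  exists x z, [/\ walkset s x, walkset t z & y = x * z].
Proof.
elim: s y => [|p s IH] y /=.
  split=> [ty|[x [z [-> tz ->]]]]; last by rewrite mul1g.
  by exists 1, y; rewrite mul1g.
split=> [[x [z [px /IH[x' [z' [sx' tz' ->]]] ->]]]|].
  by exists (x * x'), z'; rewrite mulgA; split=> //; exists x, x'.
move=> [_ [z [[x [x' [px sx' ->]]] tz ->]]].
by exists x, (x' * z); rewrite mulgA; split=> //; apply/IH; exists x', z.
Qed.

Lemma walkset_cat (s t : seq (X * X)) x z :
  walkset s x -> walkset t z -> walkset (s ++ t) (x * z).
Proof. by move=> sx tz; apply/walkset_catP; exists x, z. Qed.

Lemma walkset1 u v x : walk u x v -> walkset [:: (u, v)] x.
Proof. by move=> ux; exists x, 1; rewrite mulg1. Qed.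

(** In the lift of a connected piece to the Cayley graph of [G], at most one state then lies above
    each vertex. *)
Definition separates (G : groupType) (phi : F -> G) : Prop :=
  forall u x v x' v', walk u x v -> walk u x' v' -> phi x = phi x' -> v = v'.

(** The inductive claim; each extension by the flow raises [n] by one. *)
Definition lifts n (G : groupType) (phi : F -> G) : Prop :=
  forall s, (size s <= n)%N -> walks s -> phi (label s) = 1 ->
  walkset (map ends s) 1.

End Walks.

(** * Flows on a Cayley graph and their divergence *)

Section Flow.
Variables (F : groupType) (gT : finGroupType) (phi : F -> gT).
Hypothesis phiP : monoid.monoid_morphism phi.
Variables (A : finType) (a : A -> F) (R : nzRingType) (c : F -> gT -> A -> R).

(* [c x g b] counts with signs how often the path labelled x starting at 1 in
   the Cayley graph of gT traverses the edge g --b--> g * phi b. *)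
Definition flow : Prop :=
  (forall x y g b, c (x * y) g b = (c x g b + c y ((phi x)^-1 * g)%g b)%R) /\
  (forall b' g b, c (a b') g b = ((g == 1%g) && (b == b'))%:R%R).

Hypothesis cP : flow.

Lemma flow1 g b : c 1 g b = 0%R.
Proof.
have := cP.1 1 1 g b; rewrite mulg1 (mmorph1 phiP) invg1 mul1g => /eqP.
by rewrite -subr_eq0 opprD addrA subrr sub0r oppr_eq0 => /eqP.
Qed.

Lemma flowV x g b : c x^-1 g b = (- c x (phi x * g)%g b)%R.
Proof.
have := cP.1 x x^-1 (phi x * g) b; rewrite mulgV flow1 mulKg => /esym/eqP.
by rewrite addrC addr_eq0 => /eqP.
Qed.

(** Kirchhoff's law for a unit flow from [1] to [phi x], tested against a potential [chi]. *)
Definition divergence_at (x : F) : Prop := forall chi : gT -> R,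
  (\sum_g \sum_b c x g b * (chi (g * phi (a b))%g - chi g))%R =
  (chi (phi x) - chi 1%g)%R.

Lemma divergence1 : divergence_at 1.
Proof.
move=> chi; rewrite (mmorph1 phiP) [RHS]subrr; apply: big1 => g _; apply: big1 => b _.
by rewrite flow1 mul0r.
Qed.

Lemma divergence_split x y (chi : gT -> R) :
  (\sum_g \sum_b c (x * y)%g g b * (chi (g * phi (a b))%g - chi g))%R =
  (\sum_g \sum_b c x g b * (chi (g * phi (a b))%g - chi g) +
   \sum_g \sum_b c y g b *
      (chi (phi x * (g * phi (a b)))%g - chi (phi x * g)%g))%R.
Proof.
rewrite [X in (_ + X)%R](reindex_inj (mulgI (phi x)^-1)) /= -big_split /=.
apply: eq_bigr => g _; rewrite -big_split /=; apply: eq_bigr => b _.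
by rewrite cP.1 mulrDl !mulgA mulgV mul1g.
Qed.

Lemma divergenceM x y : divergence_at x -> divergence_at y -> divergence_at (x * y).
Proof.
move=> dx dy chi; rewrite divergence_split dx (dy (fun g => chi (phi x * g))).
by rewrite mulg1 (mmorphM phiP) addrC addrA subrK.
Qed.

Lemma divergenceV x : divergence_at x -> divergence_at x^-1.
Proof.
move=> dx chi; have := divergence_split x x^-1 (fun g => chi ((phi x)^-1 * g)).
rewrite mulgV divergence1 dx /= (mmorph1 phiP) (mmorphV phiP) mulVg mulg1 subrr.
under [X in (_ = _ + X)%R]eq_bigr do under eq_bigr do rewrite !mulKg.
by move=> /esym/eqP; rewrite addrC addr_eq0 opprB => /eqP.
Qed.

Lemma divergence_letter b' : divergence_at (a b').
Proof.
move=> chi; rewrite (bigD1 1%g) //= [X in (_ + X)%R]big1 ?addr0; last first.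
  move=> g /negPf g1; apply: big1 => b _.
  by rewrite cP.2 g1 mul0r.
rewrite (bigD1 b') //= [X in (_ + X)%R]big1 ?addr0; last first.
  by move=> b /negPf bb; rewrite cP.2 bb andbF mul0r.
by rewrite cP.2 !eqxx mul1r mul1g.
Qed.

Variables (X : Type) (E : X -> F -> X -> Prop).
Hypothesis E_letter : forall u b v, E u b v -> exists b', b = a b'.

Lemma divergence_walk u x v : walk E u x v -> divergence_at x.
Proof.
elim=> [|z v' b w' _ IH /E_letter[b' ->]|z v' b w' _ IH /E_letter[b' ->]].
- exact: divergence1.
- by apply: divergenceM => //; exact: divergence_letter.
- by apply: divergenceM => //; apply: divergenceV; exact: divergence_letter.
Qed.

(** Were [phi x] outside [Y], the indicator of [Y] as potential would give 0, since no edge carrying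
    flow crosses the cut, but also -1. *)
Lemma flow_cut u x v (Y : gT -> Prop) : walk E u x v ->
  (forall g b, c x g b <> 0%R -> Y g <-> Y (g * phi (a b))) ->
  Y 1 -> Y (phi x).
Proof.
move=> /divergence_walk dx YE Y1; apply: contrapT => nY.
have := dx (fun g => (`[< Y g >])%:R%R).
rewrite (asboolT Y1) (asboolF nY) big1 => [|g _]; last first.
  apply: big1 => b _; have [->|/eqP cx] := eqVneq (c x g b) 0%R; first by rewrite mul0r.
  by rewrite (asbool_equiv_eq (YE g b cx)) subrr mulr0.
by move=> /esym/eqP; rewrite sub0r oppr_eq0 oner_eq0.
Qed.

Lemma flow_walk_edge u x v g b : walk E u x v -> c x g b <> 0%R ->
  exists z w w', [/\ walk E u z w, phi z = g & E w (a b) w'].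
Proof.
elim=> [|z v' b' w' uz IH e|z v' b' w' uz IH e]; first by rewrite flow1.
  have [b0 b0E] := E_letter e; rewrite cP.1 b0E cP.2.
  have [/IH//|/(@contrapT _) ->] := pselect (c z g b <> 0%R).
  rewrite add0r; case: eqP => //= zg; case: eqP => // -> _.
  exists z, v', w'; rewrite -b0E; split=> //.
  by apply: (mulgI (phi z)^-1); rewrite zg mulVg.
(* A backward step traverses an edge whose tail is the end of the step, so the walk to that tail
   includes the step. *)
have [b0 b0E] := E_letter e; rewrite cP.1 b0E flowV cP.2.
have [/IH//|/(@contrapT _) ->] := pselect (c z g b <> 0%R).
rewrite add0r; case: eqP => /= [zg|_]; last by rewrite oppr0.
case: eqP => [->|_]; last by rewrite oppr0.
move=> _; exists (z * b'^-1), w', v'; rewrite -b0E; split=> //.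
  exact: walk_bwd uz e.
apply: (mulgI (phi (z * b'^-1))^-1); rewrite mulVg -zg.
by rewrite (mmorphM phiP) (mmorphV phiP) invMg invgK b0E mulgA.
Qed.

Lemma flow_walks_edge s g b : walks E s -> c (label s) g b <> 0%R ->
  exists s1 u x v s2 z w w',
    [/\ s = s1 ++ (u, x, v) :: s2, walk E u z w,
        phi (label s1 * z) = g & E w (a b) w'].
Proof.
elim: s g => [|[[u x] v] s IH] g /=; first by rewrite /label big_nil flow1.
move=> [ux sW]; rewrite label_cons cP.1 /=.
have [|/(@contrapT _) ->] := pselect (c x g b <> 0%R).
  move=> /(flow_walk_edge ux)[z [w [w' [uz zg e]]]] _.
  by exists [::], u, x, v, s, z, w, w'; rewrite /label big_nil mul1g.
rewrite add0r => /(IH _ sW)[s1 [u' [x' [v' [s2 [z [w [w' [-> uz zg e]]]]]]]]].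
exists ((u, x, v) :: s1), u', x', v', s2, z, w, w'; split=> //.
by rewrite label_cons -mulgA (mmorphM phiP) zg mulKVg.
Qed.

End Flow.

(** * The induction step: closed products with zero flow *)

Section Lift.
Variables (F : groupType) (gT : finGroupType) (phi : F -> gT).
Hypothesis phiP : monoid.monoid_morphism phi.
Variables (X : Type) (E : X -> F -> X -> Prop).
Hypothesis phi_sep : separates E phi.
Variable n : nat.
Hypothesis phi_lifts : lifts E n phi.
Variables (u1 : X) (q1 : F) (v1 : X) (t : seq (X * F * X)).
Hypothesis size_t : (size t <= n)%N.
Hypothesis q1_walk : walk E u1 q1 v1.
Hypothesis t_walks : walks E t.
Hypothesis phi_qt : phi (q1 * label t) = 1.
Implicit Types (u v w y : X) (z x : F) (g : gT).

(* The piece (u, x, v) of t, lifted to the Cayley graph of gT so that it starts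
   where q1 and t1 lead, lies in a connected lift of E which contains the
   vertex g, above the state y. *)
Definition meets t1 u x v t2 g y : Prop :=
  t = t1 ++ (u, x, v) :: t2 /\
  exists z, walk E u z y /\ phi (q1 * label t1 * z) = g.

Lemma walks_piece t1 u x v t2 : t = t1 ++ (u, x, v) :: t2 ->
  [/\ walks E t1, walk E u x v & walks E t2].
Proof. by move=> tE; move: t_walks; rewrite tE => /walks_cat[? [? ?]]. Qed.

(* The vertex g of the lift of q1 is joined to 1 by a walk r such that going along
   r to g and from there along the rest of t is a closed product in the free
   group, up to replacing labels with fixed endpoints. *)
Definition closes g : Prop := exists w r, [/\ walk E u1 r w, phi r = g &
  exists t1 u x v t2 y, meets t1 u x v t2 g y /\
    walkset E [:: (u1, w), (y, v) & map (@ends F X) t2] 1].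

(* [closes] does not depend on the piece of t through which g is met: the pieces
   between two such pieces, or the tail after a piece that is not the first,
   form a closed product of at most n factors. *)
Lemma closes_transfer g w r t1 u x v t2 y :
    closes g -> walk E u1 r w -> phi r = g -> meets t1 u x v t2 g y ->
  walkset E [:: (u1, w), (y, v) & map (@ends F X) t2] 1.
Proof.
move=> [w' [r' [r'w r'g]]] [t1' [u' [x' [v' [t2' [y' [[tE' [z' [z'w z'g]]] W]]]]]]].
move=> rw rg [tE [z [zw zg]]].
have ww : w' = w by apply: (phi_sep r'w rw); rewrite r'g.
rewrite {w'}ww in r'w W.
have [t1W xW t2W] := walks_piece tE.
have [t1W' xW' t2W'] := walks_piece tE'.
have yv : walk E y (z^-1 * x) v by apply: walk_cat xW; exact: walk_rev.
(* If [t1] is nonempty, dropping it makes room for the factor [r]. *)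
case: t1 tE zg t1W => [|[[u0 x0] v0] t1] tE zg t1W; last first.
  apply: (phi_lifts (s := [:: (u1, r, w), (y, z^-1 * x, v) & t2])) => //=.
    by apply: leq_trans size_t; rewrite tE /= size_cat /= !addnS !ltnS leq_addl.
  have := phi_qt; rewrite tE label_cat !label_cons /= => <-.
  rewrite !(mmorphM phiP) !(mmorphV phiP) rg -zg !(mmorphM phiP) label_cons.
  by rewrite !(mmorphM phiP) /= !mulgA mulgK.
case: t1' tE' z'g t1W' => [|[[u0' x0'] v0'] t1'] tE' z'g t1W'.
  move: tE'; rewrite tE /= => -[ux xx vv tt]; subst u' x' v' t2'.
  suff <- : y' = y by [].
  apply: (phi_sep z'w zw); apply: (mulgI (phi (q1 * label [::]))).
  by move: z'g; rewrite -zg !(mmorphM phiP); apply.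
(* The given piece is first and the one from [closes] comes later: the part of [t] between the two
   meeting points is a closed product, which is spliced into the one from [closes]. *)
move: tE'; rewrite tE /= => -[ux xx vv tt]; subst u0' x0' v0' t2.
have := phi_lifts (s := (y, z^-1 * x, v) :: t1' ++ [:: (u', z', y')]).
rewrite /= map_cat => /(_ _ _ _)[].
- by apply: leq_trans size_t; rewrite tE /= !size_cat /= addn1 addnS !ltnS leq_addr.
- by split=> //; apply/walks_cat; case: t1W' => _ ?; split=> //=.
- rewrite label_cons label_cat label_cons /label big_nil /= mulg1.
  have <- : g^-1 * g = 1 by rewrite mulVg.
  rewrite -{1}zg -z'g !label_cons /label big_nil !(mmorphM phiP) /=.
  by rewrite !(mmorphV phiP) (mmorph1 phiP) mulg1 invMg !mulgA mulgKV.
move=> a [m [yv' /walkset_catP[b [b' [t1b [b'' [_ [b''W -> ->]]] ->]]] aE]].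
case: W => r0 [m' [r0W [c [d [cW dW ->]]] rE]].
exists r0, (a * (b * (b'' * (c * d)))); split=> //.
  exists a, (b * (b'' * (c * d))); split=> //.
  rewrite map_cat; apply: walkset_cat => //; exists (b'' * c), d.
  by rewrite !mulgA; split=> //; exact: walk_cat b''W cW.
rewrite rE; congr (_ * _); move: aE; rewrite /= mulg1 !mulgA => <-.
by rewrite mul1g.
Qed.

(** Inserting [e * e^-1] between the first two factors moves the meeting point along an edge common
    to both lifts. *)
Lemma closes_step g r w e w' t1 u x v t2 y y' : closes g ->
    walk E u1 r w -> phi r = g -> walk E w e w' ->
    meets t1 u x v t2 g y -> walk E y e y' ->
  closes (g * phi e).
Proof.
move=> Cg rw rg we M ye.
have [r' [m [r'w [c [d [yc dW ->]]] rE]]] := closes_transfer Cg rw rg M.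
exists w', (r * e); split; first exact: walk_cat rw we.
  by rewrite (mmorphM phiP) rg.
exists t1, u, x, v, t2, y'; split.
  case: M => tE [z [uz zg]]; split=> //; exists (z * e); split.
    exact: walk_cat uz ye.
  by rewrite mulgA (mmorphM phiP) zg.
exists (r' * e), (e^-1 * c * d); split; first exact: walk_cat r'w we.
  exists (e^-1 * c), d; split=> //.
  by apply: walk_cat yc; exact: walk_rev.
by rewrite -!mulgA mulVKg.
Qed.

(** The whole product maps to [1], so the last piece of [t] ends above [1], where empty walks
    suffice. *)
Lemma closes1 : t <> [::] -> closes 1.
Proof.
case/lastP tE: t => [//|t1 [[u x] v]] _; rewrite -cats1 in tE.
exists u1, 1; split; [exact: walk_nil|exact: (mmorph1 phiP)|].
have [_ ux _] := walks_piece tE.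
exists t1, u, x, v, [::], v; split.
  split=> //; exists x; split=> //; rewrite -phi_qt tE label_cat label_cons.
  by rewrite /label big_nil mulg1 mulgA.
exists 1, 1; rewrite mulg1; split=> //; first exact: walk_nil.
by exists 1, 1; rewrite mulg1; split=> //; exact: walk_nil.
Qed.

Variables (A : finType) (a : A -> F) (R : nzRingType) (c : F -> gT -> A -> R).
Hypothesis cP : flow phi a c.
Hypothesis E_letter : forall u b v, E u b v -> exists b', b = a b'.
Hypothesis c_qt : forall g b, c (q1 * label t) g b = 0%R.

(** The cut is [closes]: where [q1] has flow, [label t] has the opposite flow, so a piece of [t]
    shares the edge and [closes_step] crosses it in both directions. *)
Lemma closes_end : t <> [::] -> closes (phi q1).
Proof.
move=> /closes1 C1; apply: (flow_cut phiP cP E_letter q1_walk _ C1) => g b cq.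
have [r [w [w' [rw rg e]]]] := flow_walk_edge phiP cP E_letter q1_walk cq.
have ct : c (label t) ((phi q1)^-1 * g) b <> 0%R.
  by move=> c0; have := c_qt g b; rewrite cP.1 c0 addr0.
have [t1 [u [x [v [t2 [z [y [y' [tE uz zg e']]]]]]]]] :=
  flow_walks_edge phiP cP E_letter t_walks ct.
have qzg : phi (q1 * label t1 * z) = g.
  by rewrite -mulgA (mmorphM phiP) zg mulKVg.
have M : meets t1 u x v t2 g y by split=> //; exists z.
have [we ye] := (walk_edge e, walk_edge e').
split=> [Cg|Cg]; first exact: closes_step Cg rw rg we M ye.
have -> : g = g * phi (a b) * phi (a b)^-1.
  by rewrite (mmorphV phiP) mulgK.
apply: closes_step Cg (walk_cat rw we) _ (walk_rev we) _ (walk_rev ye).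
  by rewrite (mmorphM phiP) rg.
split; first exact: tE.
exists (z * a b); split; first exact: walk_cat uz ye.
by rewrite mulgA (mmorphM phiP) qzg.
Qed.

(** At [phi q1] the walk [r] can be [q1] itself and the meeting point the origin of the first piece
    of [t], so the endpoints are the original ones. *)
Lemma walkset_closed : walkset E (map (@ends F X) ((u1, q1, v1) :: t)) 1.
Proof.
case tE: t => [|[[u x] v] t2].
  have -> : v1 = u1.
    apply: (phi_sep q1_walk (walk_nil E u1)); rewrite (mmorph1 phiP) -phi_qt tE.
    by rewrite /label big_nil mulg1.
  by apply: walkset1; exact: walk_nil.
have /closes_end Cq : t <> [::] by rewrite tE.
apply: (closes_transfer Cq q1_walk erefl (t1 := [::]) (u := u) (x := x)).
split; first by rewrite tE.
by exists 1; rewrite /label big_nil !mulg1; split=> //; exact: walk_nil.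
Qed.

End Lift.

Lemma lifts_succ (F : groupType) (gT : finGroupType) (phi : F -> gT)
    (X : Type) (E : X -> F -> X -> Prop) (A : finType) (a : A -> F)
    (R : nzRingType) (c : F -> gT -> A -> R) (n : nat)
    (rT : groupType) (psi : F -> rT) :
  monoid.monoid_morphism phi -> flow phi a c ->
  (forall u b v, E u b v -> exists b', b = a b') ->
  (forall x, psi x = 1 -> phi x = 1 /\ forall g b, c x g b = 0%R) ->
  separates E phi -> lifts E n phi -> lifts E n.+1 psi.
Proof.
move=> phiP cP E_letter psiP phi_sep phi_lifts [//|[[u q] v] t] st [uq tW].
rewrite label_cons => /psiP[phi_qt c_qt].
exact: (walkset_closed phiP phi_sep phi_lifts st uq tW phi_qt cP E_letter c_qt).
Qed.

(** * The extension of a group by functions on its Cayley graph *)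

Section Wreath.
Variables (gT : finGroupType) (A : finType) (m : nat).

(* The semidirect product of gT with the functions from the edges of a Cayley
   graph of gT to Z/m; the first component is written additively. *)
Definition wreath : Type := ({ffun gT * A -> 'Z_m} * gT)%type.

HB.instance Definition _ := Finite.on wreath.

Definition wreath_mul (x y : wreath) : wreath :=
  ([ffun e => x.1 e + y.1 ((x.2)^-1 * e.1, e.2)%g]%R, x.2 * y.2).

Definition wreath_one : wreath := ([ffun=> 0%R], 1).

Definition wreath_inv (x : wreath) : wreath :=
  ([ffun e => - x.1 (x.2 * e.1, e.2)%g]%R, (x.2)^-1).

Lemma wreath_mulA : associative wreath_mul.
Proof.
move=> x y z; congr pair; last exact: mulgA.
by apply/ffunP => e; rewrite !ffunE addrA invMg mulgA.
Qed.

Lemma wreath_mul1 : left_id wreath_one wreath_mul.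
Proof.
move=> [f g]; congr pair; last exact: mul1g.
by apply/ffunP => -[h b]; rewrite !ffunE /= invg1 mul1g add0r.
Qed.

Lemma wreath_mulV : left_inverse wreath_one wreath_inv wreath_mul.
Proof.
move=> [f g]; congr pair; last exact: mulVg.
by apply/ffunP => -[h b]; rewrite !ffunE /= invgK addNr.
Qed.

HB.instance Definition _ :=
  Finite_isGroup.Build wreath wreath_mulA wreath_mul1 wreath_mulV.

Lemma wreathM1 (x y : wreath) e :
  (x * y).1 e = (x.1 e + y.1 ((x.2)^-1 * e.1, e.2)%g)%R.
Proof. by rewrite [LHS]ffunE. Qed.

Lemma wreathM2 : {morph (fun x : wreath => x.2) : x y / x * y}.
Proof. by []. Qed.

Variables (V : pseudovariety) (G : {group gT}).
Hypotheses (hV : abelian_extension_closed V) (VG : V gT G).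
Hypothesis VZ : V 'Z_m [set: 'Z_m]%G.

Definition wreath_set : {set wreath} := [set x | x.2 \in G]%SET.

Lemma wreath_group_set : group_set wreath_set.
Proof.
apply/group_setP; split=> [|x y]; rewrite !inE; first exact: group1.
by move=> ? ?; rewrite wreathM2 groupM.
Qed.

Canonical wreath_group := Group wreath_group_set.

Definition wreath_snd := Morphism (D := wreath_group) (in2W wreathM2).

Lemma wreath_kerP x : x \in 'ker wreath_snd -> x.2 = 1.
Proof. by move/mker. Qed.

(** The function part embeds the kernel in a finite power of Z/m. *)
Lemma wreath_ker_in : V wreath ('ker wreath_snd)%G.
Proof.
pose U := {dffun forall e : gT * A, (fun=> 'Z_m : finGroupType) e}.
pose h (x : wreath) : U := [ffun e => x.1 e].
have hM : {in 'ker wreath_snd &, {morph h : x y / x * y}}.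
  move=> x y /wreath_kerP x2 _; apply/ffunP => -[g b].
  by rewrite !ffunE x2 invg1 mul1g.
pose f := Morphism hM.
have f_inj : 'injm f.
  apply/injmP => x y /wreath_kerP x2 /wreath_kerP y2 /ffunP hxy.
  have xy1 : x.1 = y.1 by apply/ffunP => e; have := hxy e; rewrite !ffunE.
  by case: x y x2 y2 xy1 {hxy} => [x1 x2] [y1 y2] /= -> -> ->.
apply: (pv_isog (G := (f @* 'ker wreath_snd)%G)).
  by rewrite isog_sym; apply: sub_isog.
apply: (@pv_sub V _ (setXn_group (fun e : gT * A => [set: 'Z_m]%G))).
  by apply/fintype.subsetP => x _; apply/setXnP => e; rewrite finset.in_setT.
exact: pv_prod.
Qed.

(** Closure under extensions with abelian kernel enters here, for the projection to [gT]. *)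
Lemma wreath_in : V wreath wreath_group.
Proof.
apply: (hV (ker_normal wreath_snd)).
- apply/centsP => x /wreath_kerP x2 y /wreath_kerP y2.
  rewrite /commute; case: x y x2 y2 => [f1 g1] [f2 g2] /= -> ->.
  congr pair; apply/ffunP => -[g b].
  by rewrite !ffunE /= !invg1 !mul1g addrC.
- exact: wreath_ker_in.
apply: (pv_isog (G := (wreath_snd @* wreath_group)%G)).
  by rewrite isog_sym; exact: first_isog.
apply: pv_sub VG; apply/fintype.subsetP => _ /morphimP[x _ xG ->].
by move: xG; rewrite inE.
Qed.

End Wreath.

(** Supplies the modulus; [x] must be nontrivial because ['Z_1] has two elements. *)
Lemma pv_Zp (V : pseudovariety) (gT : finGroupType) (G : {group gT}) x :
  V gT G -> x \in G -> x <> 1 -> V 'Z_#[x] [set: 'Z_#[x]]%G.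
Proof.
move=> VG xG /eqP x1.
have <- : Zp_group #[x] = [set: 'Z_#[x]]%G.
  by apply/val_inj; rewrite /= /Zp order_gt1 x1.
apply: (pv_isog (G := <[x]>%G)); first by rewrite isog_sym; exact: Zp_isog.
by apply: pv_sub VG; rewrite cycle_subG.
Qed.

Definition hom_to (V : pseudovariety) (F : groupType) (gT : finGroupType)
    (phi : F -> gT) : Prop :=
  monoid.monoid_morphism phi /\
  exists2 G : {group gT}, V gT G & forall x, phi x \in G.

(** * Iterated extensions of homomorphisms from a free group *)

Section Extension.
Variables (V : pseudovariety) (F : groupType) (B : set F).
Hypotheses (hV : abelian_extension_closed V) (FB : free_basis B).

Lemma free_hom_eq (G : groupType) (f g : F -> G) :
  monoid.monoid_morphism f -> monoid.monoid_morphism g ->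
  (forall b, B b -> f b = g b) -> f =1 g.
Proof.
move=> fP gP fg x; have [h [_ hU]] := FB g.
have <- : h = f by apply: hU; split=> // b /set_mem; exact: fg.
by have <- : h = g by apply: hU; split.
Qed.

Variables (A : finType) (a : A -> F) (m : nat).
Hypotheses (a_inj : injective a) (aB : forall b, B (a b)).
Hypothesis VZ : V 'Z_m [set: 'Z_m]%G.

(** The flow is a crossed homomorphism, so paired with [phi] it becomes a homomorphism, which
    freeness allows to prescribe on the basis. *)
Lemma flow_extension (gT : finGroupType) (phi : F -> gT) : hom_to V phi ->
  exists (rT : finGroupType) (psi : F -> rT) (c : F -> gT -> A -> 'Z_m),
    [/\ hom_to V psi, flow phi a c &
     forall x, psi x = 1 -> phi x = 1 /\ forall g b, c x g b = 0%R].
Proof.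
move=> [phiP [G VG phiG]].
pose W := wreath gT A m.
(* A letter gets the unit flow on its edge at [1], any other basis element the zero flow. *)
pose f (x : F) : W := ([ffun e => ((e.1 == 1%g) && (a e.2 == x))%:R%R], phi x).
have [psi [[psiP psiB] _]] := FB f.
have psi2 x : (psi x).2 = phi x.
  apply: (free_hom_eq (f := fun x => (psi x).2)) => //.
    by split=> [|y z]; rewrite ?(mmorph1 psiP) // (mmorphM psiP) wreathM2.
  by move=> b Bb; rewrite psiB //; exact/mem_set.
exists W, psi, (fun x g b => (psi x).1 (g, b)); split.
- split=> //; exists (wreath_group A m G); first exact: wreath_in.
  by move=> x; rewrite inE psi2.
- split=> [x y g b|b' g b]; first by rewrite (mmorphM psiP) wreathM1 psi2.
  rewrite psiB; last exact/mem_set.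
  by rewrite ffunE /= (inj_eq a_inj) (eq_sym b).
- by move=> x x1; rewrite -psi2 x1; split=> // g b; rewrite ffunE.
Qed.

Variables (X : Type) (E : X -> F -> X -> Prop).
Hypothesis E_letter : forall u b v, E u b v -> exists b', b = a b'.

Lemma exists_lifts (gT : finGroupType) (phi : F -> gT) n :
  hom_to V phi -> separates E phi ->
  exists (rT : finGroupType) (psi : F -> rT),
    [/\ hom_to V psi, separates E psi & lifts E n psi].
Proof.
move=> Vphi sphi; elim: n => [|n [rT [psi [Vpsi spsi lpsi]]]].
  by exists gT, phi; split=> // -[].
have [sT [chi [c [Vchi cP chiP]]]] := flow_extension Vpsi.
exists sT, chi; split=> //; last first.
  exact: (lifts_succ Vpsi.1 cP E_letter chiP spsi lpsi).
(* The kernel of [chi] lies in that of [psi], so separation is inherited. *)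
move=> u x v x' v' ux ux' xx'; apply: (spsi u x v x' v') => //.
have [|xx1 _] := chiP (x^-1 * x').
  by rewrite (mmorphM Vchi.1) (mmorphV Vchi.1) xx' mulVg.
apply: (mulgI (psi x)^-1); rewrite mulVg -xx1.
by rewrite (mmorphM Vpsi.1) (mmorphV Vpsi.1).
Qed.

End Extension.

(** * A free group is generated by its basis *)

Section SubgroupType.
Variables (F : groupType) (K : set F).
Hypothesis sK : subgroup K.

Definition subgroup_type : Type := {x : F | x \in K}.

HB.instance Definition _ := [isSub of subgroup_type for @sval _ _].
HB.instance Definition _ := [Choice of subgroup_type by <:].
HB.instance Definition _ := SubChoice_isSubGroup.Build F (mem K) subgroup_type sK.

(** The homomorphism to [K] that fixes [B], followed by the inclusion, is the identity by
    uniqueness. *)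
Lemma free_basis_generates (B : set F) : free_basis B -> B `<=` K -> forall x, K x.
Proof.
move=> FB BK x.
pose f (y : F) : subgroup_type := insubd (1 : subgroup_type) y.
have [psi [[psiP psiB] _]] := FB _ f.
have <- : val (psi x) = x.
  apply: (free_hom_eq FB (f := fun y => val (psi y)) (g := id)) => //.
    by split=> [|y z]; rewrite ?(mmorph1 psiP) ?(mmorphM psiP).
  move=> b Bb; rewrite psiB; last exact/mem_set.
  by rewrite /f insubdK //; apply/mem_set; exact: BK.
by apply/set_mem; exact: (valP (psi x)).
Qed.

End SubgroupType.

(** * Finite pieces of Schreier graphs *)

Section Cosets.
Variables (F : groupType) (n : nat) (H : 'I_n -> set F).
Hypothesis sH : forall i, subgroup (H i).

(** The right coset of [x] modulo [H i], tagged with [i] so that the graphs of different subgroups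
    stay disjoint. *)
Definition coset_state i x : 'I_n * set F := (i, [set y | H i (y * x^-1)]).

Lemma coset_state_eqP i j x y :
  coset_state i x = coset_state j y <-> i = j /\ H i (x * y^-1).
Proof.
split=> [[<- /seteqP[xy _]]|[<- xy]].
  by split=> //; apply: xy => /=; rewrite mulgV; exact: subgroup1.
congr pair; apply/seteqP; split=> z /= zH.
  by have := subgroupM (sH i) zH xy; rewrite mulgA mulgKV.
have := subgroupM (sH i) zH (subgroupV (sH i) xy).
by rewrite invMg invgK mulgA mulgKV.
Qed.

(* The edges Hi x --b--> Hi (x * b) of the Schreier graphs of the Hi, for
   (i, x, b) in a finite list T. *)
Definition schreier (T : seq ('I_n * F * F)) u b v : Prop :=
  exists i x, [/\ (i, x, b) \in T, u = coset_state i x & v = coset_state i (x * b)].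

Lemma walk_subset (T T' : seq ('I_n * F * F)) u z v :
  {subset T <= T'} -> walk (schreier T) u z v -> walk (schreier T') u z v.
Proof.
move=> TT';
  elim=> [|y w b w' _ IH [i [x [/TT' ? ? ?]]]|y w b w' _ IH [i [x [/TT' ? ? ?]]]].
- exact: walk_nil.
- by apply: walk_fwd IH _; exists i, x.
- by apply: walk_bwd IH _; exists i, x.
Qed.

Lemma walk_coset T i x z v :
  walk (schreier T) (coset_state i x) z v -> v = coset_state i (x * z).
Proof.
elim=> [|y w b w' _ -> [j [x' [_ /coset_state_eqP[<- xx'] ->]]]|
         y w b w' _ -> [j [x' [_ -> /coset_state_eqP[<- xx']]]]].
- by rewrite mulg1.
- apply/coset_state_eqP; split=> //.
  by have := subgroupV (sH i) xx'; rewrite !invMg !invgK !mulgA mulgK.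
- apply/coset_state_eqP; split=> //.
  by have := subgroupV (sH i) xx'; rewrite !invMg !invgK !mulgA.
Qed.

Definition vertices (T : seq ('I_n * F * F)) : seq ('I_n * F) :=
  [seq p.1 | p <- T] ++ [seq (p.1.1, p.1.2 * p.2) | p <- T].

Definition vertex T u : Prop :=
  exists i x, (i, x) \in vertices T /\ u = coset_state i x.

Lemma schreier_vertex T u b v : schreier T u b v -> vertex T u /\ vertex T v.
Proof.
move=> [i [x [xT -> ->]]]; split.
  exists i, x; split=> //; rewrite mem_cat; apply/orP; left.
  exact: (map_f (fun p : 'I_n * F * F => p.1) xT).
exists i, (x * b); split=> //; rewrite mem_cat; apply/orP; right.
exact: (map_f (fun p : 'I_n * F * F => (p.1.1, p.1.2 * p.2)) xT).
Qed.

(** The empty walk is an exception: it can start at any state, also off the finite graph. *)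
Lemma walk_vertex T u z v :
  walk (schreier T) u z v -> v = u \/ vertex T u /\ vertex T v.
Proof.
by elim=> [|y w b w' _ IH /schreier_vertex[? ?]|y w b w' _ IH /schreier_vertex[? ?]];
  [left| right; case: IH => [<-|[]]..].
Qed.

(** Reduces separation to finitely many conditions, on quotients of vertex representatives. *)
Lemma separates_schreier T (G : groupType) (phi : F -> G) :
  monoid.monoid_morphism phi ->
  (forall i x y, (i, x) \in vertices T -> (i, y) \in vertices T ->
    (exists2 h, H i h & phi (x * y^-1) = phi h) -> H i (x * y^-1)) ->
  separates (schreier T) phi.
Proof.
move=> phiP phiT u x v x' v' ux ux' xx'.
have [|vv'] := pselect (v = v'); first by [].
have [[i [y [yT vE]]] [i' [y' [yT' vE']]] [j [z [zT uE]]]] :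
    [/\ vertex T v, vertex T v' & vertex T u].
  have := walk_vertex ux; have := walk_vertex ux'.
  by move=> [v'u|[uV v'V]] [vu|[uV' vV]]; rewrite ?vu ?v'u //; case: vv'; rewrite vu v'u.
move: ux ux'; rewrite uE => /walk_coset vx /walk_coset vx'.
move: vx vx'; rewrite {1}vE {1}vE' => /coset_state_eqP[ij h] /coset_state_eqP[ij' h'].
subst i i'; rewrite vE vE'; apply/coset_state_eqP; split=> //.
(* The witness equals [y * x^-1 * x' * y'^-1], and [phi x = phi x']. *)
apply: phiT => //; exists (y * (z * x)^-1 * (y' * (z * x')^-1)^-1).
  by apply: subgroupM => //; exact: subgroupV.
by rewrite !invMg !invgK !(mmorphM phiP) !(mmorphV phiP) xx' !mulgA !mulgKV.
Qed.

Variable B : set F.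
Hypothesis FB : free_basis B.

Definition basis_labels (T : seq ('I_n * F * F)) : Prop :=
  forall p, p \in T -> B p.2.

Lemma exists_walk i y z : exists2 T, basis_labels T &
  walk (schreier T) (coset_state i y) z (coset_state i (y * z)).
Proof.
(* Quantifying over all starting cosets makes [K] a subgroup; it contains [B], hence is [F]. *)
pose K : set F := [set z | forall y, exists2 T, basis_labels T &
  walk (schreier T) (coset_state i y) z (coset_state i (y * z))].
suff : K z by apply.
have KV x : K x -> K x^-1.
  move=> Kx t; have [T TB tx] := Kx (t * x^-1); exists T => //.
  by have := walk_rev tx; rewrite mulgKV.
apply: (free_basis_generates (K := K) _ FB).
  split=> [|x x' /set_mem Kx /set_mem/KV Kx']; apply/mem_set.
    by move=> t; exists [::] => //; rewrite mulg1; exact: walk_nil.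
  move=> t; have [T TB tx] := Kx t; have [T' TB' tx'] := Kx' (t * x).
  exists (T ++ T'); first by move=> p; rewrite mem_cat => /orP[/TB|/TB'].
  rewrite mulgA; apply: walk_cat (walk_subset _ tx) (walk_subset _ tx').
    by move=> p pT; rewrite mem_cat pT.
  by move=> p pT; rewrite mem_cat pT orbT.
move=> b Bb t; exists [:: (i, t, b)].
  by move=> p; rewrite inE => /eqP ->.
by apply: walk_edge; exists i, t; rewrite inE.
Qed.

Lemma exists_walks (r : seq ('I_n * F * F)) : exists2 T, basis_labels T &
  forall i y z, (i, y, z) \in r ->
    walk (schreier T) (coset_state i y) z (coset_state i (y * z)).
Proof.
elim: r => [|[[i y] z] r [T TB Tr]]; first by exists [::].
have [T' TB' yz] := exists_walk i y z.
exists (T ++ T'); first by move=> p; rewrite mem_cat => /orP[/TB|/TB'].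
move=> i' y' z'; rewrite inE => /orP[/eqP[-> -> ->]|/Tr yz'].
  by apply: walk_subset yz => p pT; rewrite mem_cat pT orbT.
by apply: walk_subset yz' => p pT; rewrite mem_cat pT.
Qed.

(** Loop labels at a vertex form a group, so it is enough to read the finitely many generators of
    each [H i]. *)
Lemma exists_core : (forall i, finitely_generated (H i)) ->
  forall i0 w, exists T, [/\ basis_labels T,
    forall i h, H i h -> walk (schreier T) (coset_state i 1) h (coset_state i 1)
    & walk (schreier T) (coset_state i0 1) w (coset_state i0 w)].
Proof.
move=> Hfg i0 w.
have /boolp.choice[g gP] : forall i, exists s : seq F,
    H i = subgroup_generated [set` s].
  by move=> i; have [A /finite_seqP[s ->] ->] := Hfg i; exists s.
have [T TB Tr] := exists_walks
  ((i0, 1, w) :: [seq (i, 1, x) | i <- enum 'I_n, x <- g i]).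
exists T; split=> //; last first.
  by have := Tr i0 1 w; rewrite mul1g; apply; rewrite inE eqxx.
move=> i h; rewrite gP.
pose K : set F :=
  [set h | walk (schreier T) (coset_state i 1) h (coset_state i 1)].
suff : subgroup_generated [set` g i] `<=` K by apply.
apply: smallest_sub.
  split=> [|x y /set_mem Kx /set_mem Ky]; apply/mem_set; first exact: walk_nil.
  by apply: walk_cat Kx _; exact: walk_rev.
move=> x /= xg; have := Tr i 1 x; rewrite mul1g => /(_ _).
have -> : coset_state i x = coset_state i 1.
  apply/coset_state_eqP; split=> //; rewrite invg1 mulg1 gP.
  exact: sub_gen_smallest.
apply; rewrite inE; apply/orP; right; apply/allpairsPdep.
by exists i, x; rewrite mem_enum.
Qed.

End Cosets.

(** * Separation in the pro-V topology *)

Section ProVTopology.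
Variables (V : pseudovariety) (F : groupType).

Lemma hom_to_kernel (gT : finGroupType) (phi : F -> gT) : hom_to V phi ->
  normal_subgroup (phi @^-1` [set 1]) /\ quotient_in V (phi @^-1` [set 1]).
Proof.
move=> [phiP [G VG phiG]]; apply/quotient_inP.
pose S : {set gT} := [set g | `[< range phi g >]]%SET.
have SP g : reflect (range phi g) (g \in S) by rewrite inE; exact: asboolP.
have gS : group_set S.
  apply/group_setP; split; first by apply/SP; exists 1; rewrite ?(mmorph1 phiP).
  move=> _ _ /SP[x _ <-] /SP[y _ <-]; apply/SP.
  by exists (x * y); rewrite ?(mmorphM phiP).
exists gT, (Group gS), phi; split=> //.
  by apply: pv_sub VG; apply/fintype.subsetP => _ /SP[x _ <-].
by apply/seteqP; split=> g /SP.
Qed.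

Lemma quotient_in_hom N : normal_subgroup N /\ quotient_in V N ->
  exists (gT : finGroupType) (phi : F -> gT),
    hom_to V phi /\ N = phi @^-1` [set 1].
Proof.
move=> /quotient_inP[gT [G [phi [VG phiP phiG ->]]]].
exists gT, phi; split=> //; split=> //; exists G => // x.
by have : range phi (phi x) by [exists x]; rewrite phiG.
Qed.

Lemma closure_hom_to (A : set (proV V F)) (w : F) (gT : finGroupType) (phi : F -> gT) :
  hom_to V phi -> closure A w -> exists2 y : F, A y & phi y = phi w.
Proof.
move=> Vphi /(_ (left_coset (phi @^-1` [set 1]) w))[].
  by exists (phi @^-1` [set 1]) => //; exact: hom_to_kernel.
move=> y [Ay [x /= x1 wxy]]; exists y => //.
by rewrite -wxy (mmorphM Vphi.1) x1 mulg1.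
Qed.

Lemma closed_separated (A : set (proV V F)) (w : F) : closed A ->
  exists2 N, normal_subgroup N /\ quotient_in V N &
    forall y : F, A y -> left_coset N w y -> A w.
Proof.
move=> clA; have [Aw|nAw] := pselect (A w).
  by exists setT => //; exact: quotient_inT.
apply: contrapT => noN; apply: nAw; apply: clA => U [N NV NU].
apply: contrapT => AU; apply: noN; exists N => // y Ay wy.
by case: AU; exists y; split=> //; exact: NU.
Qed.

Lemma closed_separated_seq n (H : 'I_n -> set F) (r : seq ('I_n * F)) :
  (forall i, closed (H i : set (proV V F))) ->
  exists2 N, normal_subgroup N /\ quotient_in V N &
    forall i z y, (i, z) \in r -> H i y -> left_coset N z y -> H i z.
Proof.
move=> clH; elim: r => [|[i z] r [N NV Nr]].
  by exists setT => //; exact: quotient_inT.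
have [N' NV' Nz] := closed_separated z (clH i).
exists (N `&` N'); first exact: quotient_inI.
move=> i' z' y; rewrite inE => /orP[/eqP[-> ->]|zr] Hy [t [Nt Nt'] zt].
  by apply: (Nz y) => //; exists t.
by apply: (Nr _ _ y) => //; exists t.
Qed.

(** The topology is indiscrete, so a nonempty closed set is everything. *)
Lemma closed_trivial (A : set (proV V F)) : subgroup (A : set F) -> closed A ->
  (forall (gT : finGroupType) (G : {group gT}) g, V gT G -> g \in G -> g = 1) ->
  forall w : F, A w.
Proof.
move=> sA clA V1 w; have [N /quotient_in_hom[gT [phi [[phiP [G VG phiG]] ->]]] AN] :=
  closed_separated w clA.
apply: (AN 1); first exact: subgroup1.
by apply/left_cosetP; exact: V1 VG (phiG _).
Qed.

End ProVTopology.

(** * Closedness of the product set *)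

Lemma walkset_prod (F : groupType) (X : Type) (E : X -> F -> X -> Prop)
    (I : eqType) (r : seq I) (s : I -> X) y :
  uniq r -> walkset E [seq (s i, s i) | i <- r] y ->
  exists2 h : I -> F, forall i, walk E (s i) (h i) (s i) & y = \prod_(i <- r) h i.
Proof.
elim: r y => [|i r IH] y /=.
  by move=> _ ->; exists (fun=> 1); [move=> i; exact: walk_nil|rewrite big_nil].
move=> /andP[ir ru] [x [z [ix /(IH _ ru)[h hE ->] ->]]].
(* As [i] is not in [r], changing [h] at [i] keeps the product over [r]. *)
exists (fun j => if j == i then x else h j).
  by move=> j; case: eqP => [->|].
rewrite big_cons eqxx; congr (_ * _); apply: eq_big_seq => j jr.
by case: eqP ir => // <-; rewrite jr.
Qed.

Theorem theoremA (V : pseudovariety) (hV : abelian_extension_closed V)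
    (F : groupType) (hF : free_group F)
    (n : nat) (hn : (1 <= n)%N) (H : 'I_n -> set F)
    (Hsub : forall i, subgroup (H i))
    (Hfg : forall i, finitely_generated (H i))
    (Hclosed : forall i, closed (H i : set (proV V F))) :
  closed ([set \prod_(i < n) h i | h in [set h : 'I_n -> F | forall i, H i (h i)]]
          : set (proV V F)).
Proof.
case: n hn H Hsub Hfg Hclosed => [//|n] _ H Hsub Hfg Hclosed w clw.
have [[gT0 [G0 [g0 [VG0 gG0 /eqP g01]]]]|V1] := pselect (exists (gT : finGroupType)
    (G : {group gT}) g, [/\ V gT G, g \in G & g != 1]); last first.
  have HT i x : H i x.
    apply: closed_trivial (Hsub i) (Hclosed i) _ x => gT G g VG gG.
    by apply/eqP; apply: contrapT => /negP g1; apply: V1; exists gT, G, g.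
  exists (fun i => if i == ord0 then w else 1) => //.
  by rewrite big_ord_recl /= big1 ?mulg1.
have [B FB] := hF.
have [T [TB HT wT]] := exists_core Hsub FB Hfg ord0 (w : F).
(* Whether a quotient of two vertex representatives lies in [H i] can be decided modulo [N]. *)
have [N NV NT] := closed_separated_seq
  [seq (p.1, p.2 * q.2^-1) | p <- vertices T, q <- vertices T] Hclosed.
have [gT [phi [Vphi NE]]] := quotient_in_hom NV.
have phi_sep : separates (schreier H T) phi.
  apply: separates_schreier Vphi.1 _ => // i x y xT yT [h Hh xyh].
  apply: (NT i _ h) => //.
    by apply/allpairsPdep; exists (i, x), (i, y).
  apply/left_cosetP; rewrite NE /=.
  by rewrite (mmorphM Vphi.1) (mmorphV Vphi.1) xyh mulVg.
pose A := seq_sub [seq p.2 | p <- T].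
have AB (b : A) : B (val b).
  by have /mapP[p pT ->] := valP b; exact: TB.
have E_letter u b v : schreier H T u b v -> exists b' : A, b = val b'.
  move=> [i [x [xT _ _]]]; have bT := map_f snd xT.
  by exists (SeqSub bT).
have [rT [psi [Vpsi _ psi_lifts]]] := exists_lifts hV FB val_inj AB
  (pv_Zp VG0 gG0 g01) E_letter n.+1 Vphi phi_sep.
have [_ [h hH <-] psi_w] := closure_hom_to Vpsi clw.
pose base i := coset_state H i 1.
pose s := (coset_state H ord0 w, w^-1 * h ord0, base ord0) ::
  [seq (base (lift ord0 i), h (lift ord0 i), base (lift ord0 i)) | i <- index_enum 'I_n].
have := psi_lifts s; rewrite map_cons -map_comp => /(_ _ _ _)/walkset_consP[].
- by rewrite /= size_map -sum1_size sum1_card card_ord.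
- split; first by apply: walk_cat (HT _ _ (hH ord0)); exact: walk_rev.
  elim: (index_enum 'I_n) => //= i r IH; split=> //; exact: HT.
- rewrite label_cons /label big_map /= -mulgA -big_ord_recl.
  by rewrite (mmorphM Vpsi.1) (mmorphV Vpsi.1) psi_w mulVg.
move=> x [y [wx yW xy]].
have [k kW yE] :=
  walkset_prod (s := fun i => base (lift ord0 i)) (index_enum_uniq _) yW.
(* [x] leads from the coset of [w] back to [H ord0], and [x * y = 1] gives the factorization
   [w = (w * x) * y]. *)
have wxH : H ord0 (w * x).
  have /coset_state_eqP[//|_] := walk_coset Hsub wx.
  by rewrite mul1g => /(subgroupV (Hsub _)); rewrite invgK.
exists (fun i => if unlift ord0 i is Some j then k j else w * x).
  move=> i /=; case: unliftP => [j ->|->] //.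
  have /coset_state_eqP[//|_] := walk_coset Hsub (kW j).
  by rewrite !mul1g => /(subgroupV (Hsub _)); rewrite invgK.
rewrite big_ord_recl unlift_none; under eq_bigr do rewrite liftK.
by rewrite -yE -mulgA -xy mulg1.
Qed.
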